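(* Let $m,s\in\mathbb N$, let $\mathcal F$ be a Ferrers diagram of order $s$ and let $\mathcal F^m$ be its $m$-block version. Let $\delta\in[s]$ and $d\in[sm]$ be such that $d-1=m(\delta-1)+r$ with $r\in[m-1]$. Suppose that $(\mathcal F,\delta)$ is MDS-constructible, and that one of the following holds: (1) $\delta=s$; or (2) $\delta\le s-1$, $(\mathcal F,\delta+1)$ is MDS-constructible, and there exists some $j\in\{0,\dots,\delta-1\}$ such that $(\mathcal F,\delta)$ is $j$-Singleton and $(\mathcal F,\delta+1)$ is $j$-Singleton or $(j+1)$-Singleton. Then $(\mathcal F^m,d)$ is MSRD-constructible.
   Context: Notation: $\mathbb N=\{1,2,\dots\}$ and $[n]=\{1,\dots,n\}$, $[0]=\emptyset$. A (top-right justified) Ferrers diagram of order $n$ is a subset $\mathcal F\subseteq[n]^2$ such that (1) $(i,j)\in\mathcal F$ and $j<n$ imply $(i,j+1)\in\mathcal F$; (2) $(i,j)\in\mathcal F$ and $i>1$ imply $(i-1,j)\in\mathcal F$. Write $\mathcal F=[c_1,\dots,c_n]$ where $c_j$ is the number of elements of $\mathcal F$ in column $j$. For $d\in[n]$ and $j\in\{0,\dots,d-1\}$ let $\nu_j(\mathcal F,d)=\sum_{i=1}^{n-j}\max\{0,c_i-d+1+j\}$ and $\nu_{\min}(\mathcal F,d)=\min_{0\le j\le d-1}\nu_j(\mathcal F,d)$. The pair $(\mathcal F,d)$ is $j$-Singleton if $\nu_{\min}(\mathcal F,d)=\nu_j(\mathcal F,d)$ (it may be $j$-Singleton for several $j\in\{0,\dots,d-1\}$).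 Diagonals of $[n]^2$: $D_i=\{(l,n-i+l):1\le l\le i\}$, $i\in[n]$. The pair $(\mathcal F,d)$ is MDS-constructible if $\nu_{\min}(\mathcal F,d)=\sum_{i=1}^n\max\{|D_i\cap\mathcal F|-d+1,0\}$. Blocks: $Q_{i,j}=Q_{i,j}^{(m)}:=([im]\setminus[(i-1)m])\times([jm]\setminus[(j-1)m])$. A Ferrers diagram $\mathcal G$ of order $sm$ is an $m$-block Ferrers diagram if $Q_{i,j}\cap\mathcal G\in\{\emptyset,Q_{i,j}\}$ for all $i,j\in[s]$; its block set is $\mathbf B(\mathcal G)=\{Q_{i,j}: i,j\in[s],\ Q_{i,j}\subseteq\mathcal G\}$. Block diagonals: $D_i^B=\{Q_{l,s-i+l}:1\le l\le i\}$, $i\in[s]$. For an $m$-block diagram $\mathcal G$ of order $sm$ and $d\in[sm]$, $(\mathcal G,d)$ is MSRD-constructible if $\nu_{\min}(\mathcal G,d)=m\sum_{i=1}^s\max\{m|D_i^B\cap\mathbf B(\mathcal G)|-d+1,0\}$. The $m$-block version of a Ferrers diagram $\mathcal F$ of order $s$ is $\mathcal F^m:=\bigcup_{(i,j)\in\mathcal F}Q_{i,j}^{(m)}$. *)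

(* Defs.v *)
From mathcomp Require Import all_boot.

Set Implicit Arguments.
Unset Strict Implicit.
Unset Printing Implicit Defensive.

(* Row and column indices are 0-based: the cell (i, j) of ['I_n * 'I_n] stands
   for the position (i + 1, j + 1) of [n]^2.  Orders, the distances d, the
   parameter j of nu_j and the labels of diagonals are as on paper. *)

Definition ferrers (n : nat) (F : {set 'I_n * 'I_n}) : Prop :=
  (forall i j j' : 'I_n, (i, j) \in F -> j' = j.+1 :> nat -> (i, j') \in F) /\
  (forall i i' j : 'I_n, (i, j) \in F -> i = i'.+1 :> nat -> (i', j) \in F).

Definition col_card (n : nat) (F : {set 'I_n * 'I_n}) (j : 'I_n) : nat :=
  #|[set i : 'I_n | (i, j) \in F]|.

(* Here and below, truncated subtraction gives max{0, x - d + 1} = x + 1 - d. *)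
Definition nu (n : nat) (F : {set 'I_n * 'I_n}) (d j : nat) : nat :=
  \sum_(i < n | i < n - j) (col_card F i + 1 + j - d).

(* The default value [nu F d 0] is one of the minimised values when 0 < d. *)
Definition nu_min (n : nat) (F : {set 'I_n * 'I_n}) (d : nat) : nat :=
  \big[minn/nu F d 0]_(j < d) nu F d j.

Definition singleton_at (n : nat) (F : {set 'I_n * 'I_n}) (d j : nat) : Prop :=
  j < d /\ nu_min F d = nu F d j.

(* D_i = {(l, n - i + l) : 1 <= l <= i}, for 1 <= i <= n *)
Definition diag (n i : nat) : {set 'I_n * 'I_n} :=
  [set p : 'I_n * 'I_n | (p.1 < i) && (p.2 == n - i + p.1 :> nat)].

Definition MDS_constructible (n : nat) (F : {set 'I_n * 'I_n}) (d : nat) : Prop :=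
  nu_min F d = \sum_(1 <= i < n.+1) (#|diag n i :&: F| + 1 - d).

Definition block (s m : nat) (i j : 'I_s) : {set 'I_(s * m) * 'I_(s * m)} :=
  [set p : 'I_(s * m) * 'I_(s * m) |
    (i * m <= p.1 < i.+1 * m) && (j * m <= p.2 < j.+1 * m)].

Definition block_ferrers (s m : nat)
    (G : {set 'I_(s * m) * 'I_(s * m)}) : Prop :=
  ferrers G /\
  forall i j : 'I_s, block m i j :&: G = set0 \/ block m i j :&: G = block m i j.

Definition block_set (s m : nat) (G : {set 'I_(s * m) * 'I_(s * m)}) :
    {set {set 'I_(s * m) * 'I_(s * m)}} :=
  [set block m p.1 p.2 | p : 'I_s * 'I_s & block m p.1 p.2 \subset G].

Definition block_diag (s m i : nat) : {set {set 'I_(s * m) * 'I_(s * m)}} :=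
  [set block m p.1 p.2 | p in diag s i].

(* Only meaningful when [block_ferrers G] holds. *)
Definition MSRD_constructible (s m : nat)
    (G : {set 'I_(s * m) * 'I_(s * m)}) (d : nat) : Prop :=
  nu_min G d =
  m * \sum_(1 <= i < s.+1) (m * #|block_diag s m i :&: block_set G| + 1 - d).

Definition block_version (s m : nat) (F : {set 'I_s * 'I_s}) :
    {set 'I_(s * m) * 'I_(s * m)} :=
  \bigcup_(p in F) block m p.1 p.2.

Lemma block_version_ferrers (s m : nat) (F : {set 'I_s * 'I_s}) :
  ferrers F -> block_ferrers (block_version m F).
Proof.
move=> [Fr Fu].
have inI k (a b x : nat) : a * k <= x < a.+1 * k -> b * k <= x < b.+1 * k -> a = b.
  move=> /andP[ax xa] /andP[bx xb].
  have k0 : 0 < k by case: (posnP k) xa => // ->; rewrite muln0.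
  have ab : a < b.+1 by rewrite -(ltn_pmul2r k0) (leq_ltn_trans ax xb).
  have ba : b < a.+1 by rewrite -(ltn_pmul2r k0) (leq_ltn_trans bx xa).
  by apply/eqP; rewrite eqn_leq; apply/andP.
split; first split.
- move=> i j j' /bigcupP[[a b] abF]; rewrite inE /= => /andP[ia /andP[bj jb]] ej.
  have [lt|ge] := ltnP j' (b.+1 * m).
    apply/bigcupP; exists (a, b) => //; rewrite inE /= ia lt andbT.
    by rewrite ej (leq_trans bj).
  have ej' : j' = b.+1 * m :> nat by apply/eqP; rewrite eqn_leq ge ej jb.
  have m0 : 0 < m by move: (leq_ltn_trans (leq0n _) jb); rewrite muln_gt0 => /andP[].
  have bs : b.+1 < s by rewrite -(ltn_pmul2r m0) -ej' ltn_ord.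
  apply/bigcupP; exists (a, Ordinal bs); first exact: (Fr a b).
  by rewrite inE /= ia ej' leqnn ltn_pmul2r /=.
- move=> i i' j /bigcupP[[a b] abF]; rewrite inE /= => /andP[/andP[ai ia] jb] ei.
  have [ge|lt] := leqP (a * m) i'.
    apply/bigcupP; exists (a, b) => //; rewrite inE /= jb ge !andbT /=.
    by rewrite (leq_trans _ ia) // ei ltnW.
  have a0 : 0 < a by case: (nat_of_ord a) lt.
  have as_ : a.-1 < s by rewrite (leq_ltn_trans (leq_pred _) (ltn_ord a)).
  have ei' : i = a * m :> nat by apply/eqP; rewrite eqn_leq ai ei lt.
  have m0 : 0 < m by move: (leq_ltn_trans (leq0n _) lt); rewrite muln_gt0 => /andP[].
  apply/bigcupP; exists (Ordinal as_, b).
    by apply: (Fu a) abF _; rewrite /= prednK.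
  rewrite inE /= jb andbT prednK // lt andbT -ltnS -ei ei'.
  by rewrite ltn_pmul2r // prednK.
move=> i j; have [ijF|ijF] := boolP ((i, j) \in F).
  by right; apply/setIidPl; exact: (bigcup_sup (i, j)).
left; apply/setP=> -[x y]; rewrite !inE /=; apply/negP.
case/andP=> /andP[xi yj] /bigcupP[[a b] abF]; rewrite inE /= => /andP[xa yb].
by case/negP: ijF; rewrite (val_inj (inI _ _ _ _ xi xa)) (val_inj (inI _ _ _ _ yj yb)).
Qed.

(* Main.v *)
Require Import Defs.
From mathcomp Require Import all_boot.
From mathcomp Require Import zify.

(** Let c_q be the column counts of F and e_i the number of cells of F on its
i-th diagonal, and put
    R(p, y) = sum over the first p columns of max(0, c_q - y),
    S(z)    = sum over i of max(0, e_i - z).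
Then nu_j(F, d) = R(n - j, d - 1 - j) is the number of cells of F that survive
the deletion of the d - 1 - j top rows and of the j rightmost columns.  A
diagonal meets every row and every column at most once, so this deletion costs
it at most d - 1 cells; hence S(y + (n - p)) <= R(p, y) ([diag_excess_le]), and
MDS-constructible means that the bound S(d - 1) <= nu_min(F, d) is attained.

For the block version G of F the same quantities mix those of F.  Write an
index J <= d - 1 as J = m k + t and its complement as d - 1 - J = m a + u with
t, u < m.  Deleting J columns and d - 1 - J rows of G cuts through one block
column and one block row, and as max(0, m c - (m a + u)) is affine in u for
0 <= u <= m, one gets ([left_cells_block_version])
    nu_J(G, d) = (m - t) [(m - u) R(s - k, a) + u R(s - k, a + 1)]
               + t [(m - u) R(s - k - 1, a) + u R(s - k - 1, a + 1)].
With z = a + k the four values of R are at least S(z), S(z + 1), S(z + 1) and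
S(z + 2), and convexity of S turns this into
    nu_J(G, d) >= m * sum over i of max(0, m e_i - (d - 1)),
the value required by MSRD-constructibility ([block_diag_bound]).  This holds
for every Ferrers diagram and every d.

It remains to attain the bound.  For d - 1 = m (delta - 1) + r it equals
m ((m - r) S(delta - 1) + r S(delta)) ([mixed_excess]), where S(delta - 1) and
S(delta) are the minima nu_min(F, delta) and nu_min(F, delta + 1).  The index
J = m j has t = 0 and u = r and gives
    nu_J(G, d) = m ((m - r) nu_j(F, delta) + r nu_j(F, delta + 1)),
while J = m j + r has t = r and u = 0 and gives
    nu_J(G, d) = m ((m - r) nu_j(F, delta) + r nu_(j + 1)(F, delta + 1)).
So an index j that is Singleton at delta, and such that j or j + 1 is
Singleton at delta + 1, attains the bound.  If delta = s then S(s) = 0 and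
S(s - 1) <= 1, and as the columns grow to the right, a sum
R(s - j, s - 1 - j) <= 1 has no contribution outside its last column, so
R(s - j - 1, s - 1 - j) = 0 = S(s) and J = m j + r works again
([left_cells_drop_col]). *)

Set Implicit Arguments.
Unset Strict Implicit.
Unset Printing Implicit Defensive.

(** * Surviving cells and diagonals *)

(** For a Ferrers diagram, the number of cells that survive the deletion of the
first [y] rows and of all columns but the first [p]; splitting [nu] into these
two independent parameters makes it comparable across different [d]. *)
Definition left_cells n (F : {set 'I_n * 'I_n}) (p y : nat) : nat :=
  \sum_(q < n | q < p) (col_card F q - y).

Definition diag_excess n (F : {set 'I_n * 'I_n}) (z : nat) : nat :=
  \sum_(1 <= i < n.+1) (#|diag n i :&: F| - z).

Lemma nuE n (F : {set 'I_n * 'I_n}) d j :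
  j < d -> nu F d j = left_cells F (n - j) (d - 1 - j).
Proof. by move=> jd; apply: eq_bigr => q _; lia. Qed.

Lemma diag_excessE n (F : {set 'I_n * 'I_n}) d : 0 < d ->
  \sum_(1 <= i < n.+1) (#|diag n i :&: F| + 1 - d) = diag_excess F (d - 1).
Proof. by move=> d0; apply: eq_bigr => i _; lia. Qed.

(** * The minimum of nu *)

Lemma bigmin_le (I : eqType) (r : seq I) (f : I -> nat) a x :
  x \in r -> \big[minn/a]_(i <- r) f i <= f x.
Proof.
elim: r => // b r IH; rewrite inE big_cons => /predU1P[->|/IH le]; first exact: geq_minl.
exact: leq_trans (geq_minr _ _) le.
Qed.

Lemma nu_min_eq n (F : {set 'I_n * 'I_n}) d v j :
  (forall i, i < d -> v <= nu F d i) -> j < d -> nu F d j = v -> nu_min F d = v.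
Proof.
move=> lb jd ej; apply/eqP; rewrite eqn_leq; apply/andP; split.
  rewrite -ej (bigmin_le (fun i : 'I_d => nu F d i) _ (x := Ordinal jd)) //.
  exact: mem_index_enum.
rewrite /nu_min; apply: (big_ind (fun x => v <= x)) => [|x y vx vy|i _].
- by apply: lb; lia.
- by rewrite leq_min vx.
- exact: lb.
Qed.

Lemma nu_min_attained n (F : {set 'I_n * 'I_n}) d :
  0 < d -> exists j, singleton_at F d j.
Proof.
move=> d0.
suff [j jd e] : exists2 j, j < d & nu_min F d = nu F d j by exists j.
rewrite /nu_min; apply: (big_ind (fun x => exists2 j, j < d & x = nu F d j)).
- by exists 0.
- move=> x y [i id ->] [j jd ->]; rewrite /minn.
  by case: ifP => _; [exists i | exists j].
- by move=> i _; exists i.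
Qed.

(** * Diagonals of a Ferrers diagram *)

Lemma ferrers_up n (F : {set 'I_n * 'I_n}) (x x' q : 'I_n) :
  ferrers F -> (x, q) \in F -> x' <= x -> (x', q) \in F.
Proof.
case=> _ Fu; elim: {x}(x : nat) {-2}x (erefl (x : nat)) => [|k IH] x ex xF le.
  by have -> : x' = x by apply: val_inj => /=; lia.
have [e|ne] := eqVneq x' x; first by rewrite e.
have kn : k < n by have := ltn_ord x; lia.
apply: (IH (Ordinal kn)) => //=; first by apply: Fu xF _.
have : (x' : nat) != x by apply: contra_neq ne => /val_inj.
lia.
Qed.

Lemma ferrers_right n (F : {set 'I_n * 'I_n}) (x q q' : 'I_n) :
  ferrers F -> (x, q) \in F -> q <= q' -> (x, q') \in F.
Proof.
case=> Fr _; elim: {q'}(q' : nat) {-2}q' (erefl (q' : nat)) => [|k IH] q' eq' qF le.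
  by have -> : q' = q by apply: val_inj => /=; lia.
have [<- //|ne] := eqVneq q q'.
have kn : k < n by have := ltn_ord q'; lia.
apply: (Fr _ (Ordinal kn)) => //; apply: IH => //=.
have : (q : nat) != q' by apply: contra_neq ne => /val_inj.
lia.
Qed.

Lemma col_card_mono n (F : {set 'I_n * 'I_n}) (q q' : 'I_n) :
  ferrers F -> q <= q' -> col_card F q <= col_card F q'.
Proof.
move=> Ff le; apply/subset_leq_card/subsetP => x; rewrite !inE => xF.
exact: ferrers_right le.
Qed.

Lemma card_ord_interval N a b : b <= N -> #|[set i : 'I_N | a <= i < b]| = b - a.
Proof.
move=> bN; rewrite -sum1dep_card.
have <- : \sum_(a <= i < b) 1 = b - a by rewrite sum_nat_const_nat muln1.
rewrite (big_nat_widen _ _ N) // (big_nat_widenl _ 0) // big_mkord.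
by apply: eq_bigl => i; rewrite andbC.
Qed.

(** A nonempty part of a column below row [y] forces the [y] cells above it to
lie in the diagram as well. *)
Lemma col_card_low n (F : {set 'I_n * 'I_n}) (q : 'I_n) y : ferrers F ->
  #|[set x : 'I_n | ((x, q) \in F) && (y <= x)]| <= col_card F q - y.
Proof.
move=> Ff; set A := [set x : 'I_n | _].
have [->|[x]] := set_0Vmem A; first by rewrite cards0.
rewrite inE => /andP[xF yx].
pose B := [set z : 'I_n | 0 <= z < y].
have cB : #|B| = y by rewrite card_ord_interval ?subn0 //; have := ltn_ord x; lia.
have dAB : [disjoint A & B].
  by rewrite -setI_eq0; apply/eqP/setP => z; rewrite !inE; lia.
have : #|A :|: B| <= col_card F q.
  apply/subset_leq_card/subsetP => z; rewrite !inE => /orP[/andP[] //|zy].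
  by apply: ferrers_up Ff xF _; lia.
by rewrite cardsU (disjoint_setI0 dAB) cards0 cB; lia.
Qed.

Lemma diag_inj_row n i : {in diag n i &, injective (fun v : 'I_n * 'I_n => v.1)}.
Proof.
move=> [a b] [a' b']; rewrite !inE /= => /andP[_ /eqP eb] /andP[_ /eqP eb'] ea.
by congr pair => //; apply: val_inj; rewrite /= eb eb' ea.
Qed.

Lemma diag_inj_col n i : {in diag n i &, injective (fun v : 'I_n * 'I_n => v.2)}.
Proof.
move=> [a b] [a' b']; rewrite !inE /= => /andP[_ /eqP eb] /andP[_ /eqP eb'] e.
by congr pair => //; apply: val_inj => /=; move: eb; rewrite e eb'; lia.
Qed.

Lemma card_diag_le n (F : {set 'I_n * 'I_n}) i : i <= n -> #|diag n i :&: F| <= i.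
Proof.
move=> le.
rewrite -(@card_in_imset _ _ (fun v : 'I_n * 'I_n => v.1)); last first.
  by apply: sub_in2 (@diag_inj_row n i) => v /setIP[].
rewrite -[leqRHS]subn0 -(card_ord_interval 0 le).
apply/subset_leq_card/subsetP => x /imsetP[v].
by rewrite !inE => /andP[/andP[]] ? ? ? ->.
Qed.

(** The diagonals are pairwise disjoint: [(a, b)] lies only on the diagonal
with label [n + a - b]. *)
Lemma sum_card_diag_le n (V : {set 'I_n * 'I_n}) :
  \sum_(1 <= i < n.+1) #|diag n i :&: V| <= #|V|.
Proof.
have cE i : #|diag n i :&: V| = \sum_(v in V) (v \in diag n i).
  rewrite -sum1_card big_mkcond [RHS]big_mkcond.
  by apply: eq_bigr => v _; rewrite inE andbC; case: (v \in V); case: (v \in _).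
rewrite (eq_bigr _ (fun i _ => cE i)) exchange_big -sum1_card /=.
apply: leq_sum => v _.
apply: (@leq_trans (\sum_(1 <= i < n.+1) (i == n + v.1 - v.2))).
  rewrite big_nat_cond [leqRHS]big_nat_cond; apply: leq_sum => i ib.
  rewrite inE; have := ltn_ord v.1; lia.
rewrite -(big_mkcond (fun i => i == n + v.1 - v.2) (fun=> 1)) sum1_count.
by rewrite (count_uniq_mem _ (iota_uniq _ _)) leq_b1.
Qed.

(** The deleted region consists of [y] rows and [n - p] columns, and a diagonal
meets each of them at most once, so it keeps all but [y + (n - p)] of its
cells; the diagonals being disjoint, these survivors add up. *)
Lemma diag_excess_le n (F : {set 'I_n * 'I_n}) p y : ferrers F ->
  diag_excess F (y + (n - p)) <= left_cells F p y.
Proof.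
move=> Ff.
pose V := [set v in F | (y <= v.1) && (v.2 < p)].
have Vle : #|V| <= left_cells F p y.
  rewrite -sum1_card (partition_big (fun v : 'I_n * 'I_n => v.2)
    (fun q : 'I_n => q < p)) /=; last first.
    by move=> v; rewrite inE => /and3P[].
  apply: leq_sum => q qp; rewrite sum1dep_card.
  apply: leq_trans (col_card_low q y Ff).
  rewrite -(card_imset [set x : 'I_n | ((x, q) \in F) && (y <= x)]
    (f := fun x => (x, q))); last by move=> a b [].
  apply/subset_leq_card/subsetP => -[a b]; rewrite !inE /= =>
    /andP[/and3P[abF ya bp] /eqP eb].
  by apply/imsetP; exists a; rewrite -?eb // inE eb -{1}eb abF.
apply: leq_trans Vle; apply: leq_trans (sum_card_diag_le V).
apply: leq_sum => i _; rewrite leq_subLR.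
(* The cells of the diagonal lost to deleted rows, resp. deleted columns. *)
pose R := [set v in diag n i :&: F | v.1 < y].
pose C := [set v in diag n i :&: F | p <= v.2].
have cR : #|R| <= y.
  rewrite -(@card_in_imset _ _ (fun v : 'I_n * 'I_n => v.1)); last first.
    by apply: sub_in2 (@diag_inj_row n i) => v; rewrite inE => /andP[/setIP[]].
  apply: (@leq_trans #|[set x : 'I_n | 0 <= x < minn y n]|).
    apply/subset_leq_card/subsetP => x /imsetP[v]; rewrite !inE => /andP[_ vy] ->.
    by rewrite leq_min vy ltn_ord.
  by rewrite card_ord_interval; lia.
have cC : #|C| <= n - p.
  rewrite -(@card_in_imset _ _ (fun v : 'I_n * 'I_n => v.2)); last first.
    by apply: sub_in2 (@diag_inj_col n i) => v; rewrite inE => /andP[/setIP[]].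
  rewrite -(card_ord_interval p (leqnn n)).
  apply/subset_leq_card/subsetP => x /imsetP[v]; rewrite !inE => /andP[_ vp] ->.
  by rewrite vp ltn_ord.
have sub : diag n i :&: F \subset R :|: C :|: (diag n i :&: V).
  apply/subsetP => v vDF; move: (vDF) => /setIP[vd vF].
  rewrite !in_setU (in_setI v _ V) vd [v \in R]inE [v \in C]inE [v \in V]inE vDF vF /=.
  by case: ltnP; case: ltnP.
have := subset_leq_card sub.
have := (leq_card_setU (R :|: C) (diag n i :&: V)).1.
have := (leq_card_setU R C).1.
lia.
Qed.

(** * Block versions *)

Section Blocks.
Variables (m s : nat) (m0 : 0 < m).
Implicit Type F : {set 'I_s * 'I_s}.

Fact block_index_subproof (x : 'I_(s * m)) : x %/ m < s.
Proof. by rewrite ltn_divLR. Qed.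

Definition block_index (x : 'I_(s * m)) : 'I_s := Ordinal (block_index_subproof x).

Lemma block_indexE (x : 'I_(s * m)) (q : 'I_s) :
  (block_index x == q) = (q * m <= x < q.+1 * m).
Proof. by rewrite -leq_divRL // -ltn_divLR // -val_eqE /=; lia. Qed.

Lemma in_block (i j : 'I_s) (v : 'I_(s * m) * 'I_(s * m)) :
  (v \in block m i j) = ((block_index v.1, block_index v.2) == (i, j)).
Proof. by rewrite inE xpair_eqE !block_indexE. Qed.

Lemma in_block_version F (v : 'I_(s * m) * 'I_(s * m)) :
  (v \in block_version m F) = ((block_index v.1, block_index v.2) \in F).
Proof.
apply/bigcupP/idP => [[[i j] ijF]|vF]; first by rewrite in_block => /eqP ->.
by exists (block_index v.1, block_index v.2); rewrite // in_block.
Qed.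

Lemma card_block_index (q : 'I_s) X : X <= s * m ->
  #|[set x : 'I_(s * m) | (x < X) && (block_index x == q)]| =
  minn X (q.+1 * m) - q * m.
Proof.
move=> Xle; rewrite -(@card_ord_interval (s * m)); last by rewrite geq_min Xle.
by apply: eq_card => x; rewrite !inE block_indexE; lia.
Qed.

Lemma col_card_block_version F (y : 'I_(s * m)) :
  col_card (block_version m F) y = m * col_card F (block_index y).
Proof.
rewrite /col_card -sum1_card (partition_big block_index
  (fun q => q \in [set q | (q, block_index y) \in F])) /=; last first.
  by move=> x; rewrite !inE in_block_version.
rewrite [RHS]mulnC -sum_nat_const; apply: eq_bigr => q; rewrite inE => qF.
rewrite sum1dep_card -[RHS](addKn (q * m)) -mulSnr.
have qs : q.+1 * m <= s * m by rewrite leq_mul2r ltn_ord orbT.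
have <- : minn (s * m) (q.+1 * m) = q.+1 * m by lia.
rewrite -(card_block_index q (leqnn (s * m))); apply: eq_card => x.
rewrite !inE ltn_ord /= in_block_version /=.
by case: eqP => [->|_]; rewrite ?qF ?andbF.
Qed.

(** [x |-> max(0, m c - x)] is affine between the multiples [m a] and
[m (a + 1)] of [m], as its only kink is at the multiple [m c]. *)
Lemma truncated_mix c a u : u <= m ->
  m * c - (m * a + u) = (m - u) * (c - a) + u * (c - a.+1).
Proof.
move=> um; have [ca|ac] := leqP c a; first by rewrite (_ : c - a = 0) //; nia.
have -> : c = a.+1 + (c - a.+1) by lia.
by rewrite addKn (_ : a.+1 + _ - a = (c - a.+1).+1); nia.
Qed.

(** Of the first [s m - (m k + t)] columns of the block version, the last block
column keeps [m - t] of its [m] columns and the previous ones are complete,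
hence the weights [m - t] on [s - k] block columns and [t] on [s - k - 1]; the
weights [m - u] and [u] come from [truncated_mix]. *)
Lemma left_cells_block_version F k t a u : k < s -> t <= m -> u <= m ->
  left_cells (block_version m F) (s * m - (m * k + t)) (m * a + u) =
  (m - t) * ((m - u) * left_cells F (s - k) a + u * left_cells F (s - k) a.+1) +
  t * ((m - u) * left_cells F (s - k.+1) a + u * left_cells F (s - k.+1) a.+1).
Proof.
move=> ks tm um; set X := s * m - _.
have mixE p : (m - u) * left_cells F p a + u * left_cells F p a.+1 =
    \sum_(q < s) (q < p) * (m * col_card F q - (m * a + u)).
  rewrite /left_cells !big_distrr -big_split big_mkcond /=; apply: eq_bigr => q _.
  by rewrite truncated_mix //; case: ifP => _; rewrite ?mul1n ?mul0n.
(* Compare, for each block column q, the number of its surviving columns. *)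
rewrite !mixE !big_distrr -big_split /=.
rewrite /left_cells (partition_big block_index predT) //=.
apply: eq_bigr => q _.
rewrite (eq_bigr (fun=> m * col_card F q - (m * a + u))); last first.
  by move=> x /andP[_ /eqP <-]; rewrite col_card_block_version.
rewrite sum_nat_const !mulnA -mulnDl; congr (_ * _).
have Xle : X <= s * m by rewrite leq_subr.
have -> : #|[pred i : 'I_(s * m) | (i < X) && (block_index i == q)]| = minn X (q.+1 * m) - q * m.
  by rewrite -card_block_index //; apply: eq_card => x; rewrite inE.
rewrite /X; move: (nat_of_ord q) (ltn_ord q) => x xs; clear -ks tm xs.
have [xlt|xge] := ltnP x (s - k.+1).
  have [e es] : exists e, s = x + k + 2 + e by exists (s - (x + k + 2)); lia.
  by rewrite (_ : x < s - k) ?es /=; nia.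
have [xlt|xge'] := ltnP x (s - k); last by nia.
have -> : s = x + k + 1 by lia.
by nia.
Qed.

(** A block is determined by its position and lies in the block version exactly
when that position is in [F], so counting blocks amounts to counting cells. *)
Lemma block_diag_card F i :
  #|block_diag s m i :&: block_set (block_version m F)| = #|diag s i :&: F|.
Proof.
pose B (p : 'I_s * 'I_s) := block m p.1 p.2.
have corner (q : 'I_s) : exists x : 'I_(s * m), block_index x = q.
  have h : q * m < s * m by rewrite ltn_pmul2r.
  by exists (Ordinal h); apply/eqP; rewrite block_indexE /= leqnn ltn_pmul2r /=.
have corner2 p : exists v : 'I_(s * m) * 'I_(s * m), (block_index v.1, block_index v.2) = p.
  have [x ex] := corner p.1; have [y ey] := corner p.2.
  by exists (x, y); rewrite /= ex ey -surjective_pairing.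
have Binj : injective B.
  move=> p p' e; have [v ev] := corner2 p.
  have : v \in B p by rewrite in_block ev -surjective_pairing.
  by rewrite e in_block ev -surjective_pairing => /eqP.
have Bsub p : (B p \subset block_version m F) = (p \in F).
  apply/idP/idP => [/subsetP sB|pF]; last exact: (bigcup_sup p).
  have [v ev] := corner2 p.
  have := sB v; rewrite in_block ev -surjective_pairing eqxx in_block_version ev.
  exact.
rewrite -(card_imset _ Binj); apply: eq_card => Q; rewrite inE.
apply/andP/imsetP => [[/imsetP[p pd ->] /imsetP[p' ]]|[p]].
  by rewrite inE -/(B p') Bsub => p'F /Binj e; exists p; rewrite // inE pd e.
rewrite inE => /andP[pd pF] ->; split; apply/imsetP; exists p => //.
by rewrite inE -/(B p) Bsub.
Qed.

Lemma mixed_excess F z r : r <= m ->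
  \sum_(1 <= i < s.+1) (m * #|diag s i :&: F| - (m * z + r)) =
  (m - r) * diag_excess F z + r * diag_excess F z.+1.
Proof.
move=> rm; rewrite /diag_excess !big_distrr -big_split /=.
by apply: eq_bigr => i _; rewrite truncated_mix.
Qed.

(** The four sums of [left_cells_block_version] are bounded by [diag_excess] at
[z], [z + 1], [z + 1] and [z + 2] where [z = a + k].  For a single diagonal with
[e] cells, the resulting combination equals [m (m e - p)] if [e >= z + 2];
if [e = z + 1] the claim is [(m - t) (m - u) >= m max(0, m - t - u)], whose
slack is the product [t u] when [t + u <= m]. *)
Lemma block_diag_bound F p J : ferrers F -> J <= p -> p < s * m ->
  m * \sum_(1 <= i < s.+1) (m * #|diag s i :&: F| - p) <=
  left_cells (block_version m F) (s * m - J) (p - J).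
Proof.
move=> Ff Jp ps.
pose k := J %/ m; pose t := J %% m; pose a := (p - J) %/ m; pose u := (p - J) %% m.
have tm : t < m by rewrite ltn_mod.
have um : u < m by rewrite ltn_mod.
have eJ : J = m * k + t by rewrite mulnC -divn_eq.
have eY : p - J = m * a + u by rewrite mulnC -divn_eq.
have ks : k < s by rewrite ltn_divLR // (leq_ltn_trans Jp).
rewrite eY [in s * m - J]eJ left_cells_block_version ?(ltnW tm) ?(ltnW um) //.
have := diag_excess_le (s - k) a Ff.
have := diag_excess_le (s - k) a.+1 Ff.
have := diag_excess_le (s - k.+1) a Ff.
have := diag_excess_le (s - k.+1) a.+1 Ff.
have -> : s - (s - k) = k by lia.
have -> : s - (s - k.+1) = k.+1 by lia.
rewrite !addnS !addSn; set z := a + k => h4 h3 h2 h1.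
apply: (@leq_trans ((m - t) * ((m - u) * diag_excess F z + u * diag_excess F z.+1) +
  t * ((m - u) * diag_excess F z.+1 + u * diag_excess F z.+2))); last first.
  by rewrite leq_add // leq_mul // leq_add // leq_mul.
rewrite /diag_excess !big_distrr -!big_split !big_distrr -big_split /=.
apply: leq_sum => i _; set e := #|_|.
have -> : p = m * z + (t + u) by rewrite /z; lia.
clear -tm um.
have [ez|ze] := leqP e z; first by nia.
have [e1|e2] := leqP e z.+1.
  have -> : e = z.+1 by lia.
  by nia.
have -> : e = z.+2 + (e - z.+2) by lia.
set x := e - z.+2.
have -> : z.+2 + x - z = x.+2 by lia.
have -> : z.+2 + x - z.+1 = x.+1 by lia.
rewrite addKn.
(* Subtraction-free coordinates, in which both sides are the same polynomial. *)
have [m1 em] : exists m1, m = t + m1 by exists (m - t); lia.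
have [m2 em2] : exists m2, m = u + m2 by exists (m - u); lia.
have -> : m - t = m1 by lia.
have -> : m - u = m2 by lia.
have -> : m * (z.+2 + x) - (m * z + (t + u)) = m * x + m1 + m2 by nia.
nia.
Qed.

End Blocks.

(** * Attaining the bound *)

Lemma MSRD_block_versionE m s (F : {set 'I_s * 'I_s}) d : 0 < m -> 0 < d ->
  MSRD_constructible (block_version m F) d <->
  nu_min (block_version m F) d =
    m * \sum_(1 <= i < s.+1) (m * #|diag s i :&: F| - (d - 1)).
Proof.
move=> m0 d0; rewrite /MSRD_constructible.
suff -> : \sum_(1 <= i < s.+1)
    (m * #|block_diag s m i :&: block_set (block_version m F)| + 1 - d) =
    \sum_(1 <= i < s.+1) (m * #|diag s i :&: F| - (d - 1)) by [].
by apply: eq_bigr => i _; rewrite block_diag_card //; lia.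
Qed.

Lemma diag_excess_max n (F : {set 'I_n * 'I_n}) : diag_excess F n = 0.
Proof.
rewrite /diag_excess big_nat big1 // => i /andP[_ le].
by apply/eqP; rewrite subn_eq0; apply: leq_trans (card_diag_le F _) _; lia.
Qed.

(** Only the main diagonal is long enough to have [n] cells. *)
Lemma diag_excess_pred n (F : {set 'I_n * 'I_n}) : 0 < n -> diag_excess F (n - 1) <= 1.
Proof.
move=> n0; rewrite /diag_excess big_nat_recr //= big_nat big1 ?add0n.
  rewrite leq_subLR subnK //; exact: card_diag_le.
by move=> i /andP[_ le]; apply/eqP; rewrite subn_eq0; apply: leq_trans (card_diag_le F _) _; lia.
Qed.

(** The columns grow to the right, so a nonzero contribution of an earlier
column would be matched by the last one, giving a total of at least 2. *)
Lemma left_cells_drop_col n (F : {set 'I_n * 'I_n}) p y : ferrers F -> p < n ->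
  left_cells F p.+1 y <= 1 -> left_cells F p y = 0.
Proof.
move=> Ff pn; rewrite /left_cells (bigD1 (Ordinal pn)) //=.
rewrite (eq_bigl (fun q : 'I_n => q < p)); last first.
  by move=> q; rewrite -val_eqE /=; lia.
move=> le1; apply/eqP; rewrite sum_nat_eq0; apply/forallP => q; apply/implyP => qp.
have mono : col_card F q <= col_card F (Ordinal pn) by apply: col_card_mono => //=; lia.
move: le1; rewrite (bigD1 q) //=; lia.
Qed.

Theorem theorem4p27 (m s : nat) (F : {set 'I_s * 'I_s}) (delta d r : nat) :
  0 < m -> 0 < s ->
  ferrers F ->
  1 <= delta <= s ->
  1 <= d <= s * m ->
  1 <= r <= m - 1 ->
  d - 1 = m * (delta - 1) + r ->
  MDS_constructible F delta ->
  (delta = s \/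
   [/\ delta <= s - 1,
       MDS_constructible F (delta + 1) &
       exists j : nat,
         [/\ j < delta,
             singleton_at F delta j &
             singleton_at F (delta + 1) j \/ singleton_at F (delta + 1) (j + 1)]]) ->
  MSRD_constructible (block_version m F) d.
Proof.
move=> m0 s0 Ff /andP[dl0 dls] /andP[d0 ds] /andP[r0 rm] ed mds hyp.
have {}mds : nu_min F delta = diag_excess F (delta - 1) by rewrite mds diag_excessE.
have [j [jd ej ej']] : exists j, [/\ j < delta,
    left_cells F (s - j) (delta - 1 - j) = diag_excess F (delta - 1) &
    left_cells F (s - j) (delta - j) = diag_excess F delta \/
    left_cells F (s - j.+1) (delta - 1 - j) = diag_excess F delta].
  case: hyp => [e|[dls' mds' [j [jd [_ sj] sj']]]].
    have [j [jd sj]] := nu_min_attained F dl0.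
    have ej : left_cells F (s - j) (delta - 1 - j) = diag_excess F (delta - 1).
      by rewrite -nuE // -sj.
    exists j; split=> //; right; rewrite e diag_excess_max.
    apply: left_cells_drop_col => //; first lia.
    have -> : (s - j.+1).+1 = s - j by lia.
    by move: ej; rewrite e => ->; rewrite diag_excess_pred.
  have {}mds' : nu_min F (delta + 1) = diag_excess F delta.
    by rewrite mds' diag_excessE ?addn1 // subn1.
  exists j; split=> //; first by rewrite -nuE // -sj.
  case: sj' => -[lt e]; [left|right]; rewrite -mds' e nuE //; congr left_cells; lia.
apply/MSRD_block_versionE => //.
have lb i : i < d -> m * \sum_(1 <= i < s.+1) (m * #|diag s i :&: F| - (d - 1)) <=
    nu (block_version m F) d i.
  by move=> id; rewrite nuE //; apply: block_diag_bound => //; lia.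
have rlem : r <= m by lia.
have edl : (delta - 1).+1 = delta by lia.
have js : j < s by lia.
have eaj : (delta - 1 - j).+1 = delta - j by lia.
have [w wE] : exists w, w = m * (delta - 1 - j) by eexists.
have ew : d - 1 = m * j + w + r.
  by rewrite ed wE -mulnDr; congr (m * _ + _); lia.
have [lt1 lt2] : m * j < d /\ m * j + r < d by clear -ew d0; lia.
have [es1 es2] : d - 1 - m * j = w + r /\ d - 1 - (m * j + r) = w + 0.
  by rewrite ew; clear; lia.
(* The two alternatives are the indices m j (t = 0, u = r) and m j + r
   (t = r, u = 0). *)
case: ej' => ej'; [apply: (nu_min_eq lb lt1) | apply: (nu_min_eq lb lt2)].
- rewrite nuE // es1 wE -[in s * m - _](addn0 (m * j)).
  rewrite left_cells_block_version // ed mixed_excess //.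
  by rewrite eaj edl ej ej' subn0 mul0n addn0.
- rewrite nuE // es2 wE left_cells_block_version // ed mixed_excess //.
  rewrite edl ej ej' subn0 !mul0n !addn0 mulnDr; congr (_ + _); exact: mulnCA.
Qed.
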